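(* Let $u^0\in\mathscr U_L$ and let $u_N^0\in\mathscr U_N$ be the piecewise linear interpolant of $u^0$ on the grid $t_1<\dots<t_N$, i.e. $u_N^0(t)=u^0(t_{i-1})+\frac{u^0(t_i)-u^0(t_{i-1})}{t_i-t_{i-1}}(t-t_{i-1})$ for $t\in[t_{i-1},t_i]$, $i=2,\dots,N$. If $\mathscr G=\mathscr G_K\cup\mathscr G_I$, then $$|R(\xi)-R_N(\xi)|\le 10\max\{2,L\}\,\beta_N,$$ where $\beta_N:=\max_{i=2,\dots,N}(t_i-t_{i-1})$, $$R(\xi):=\max_{x\in\mathbb{R}}\min_{u\in\mathbb{B}(u^0,r)}u(x)+\mathbb{E}_P[u(\xi-x)],\qquad R_N(\xi):=\max_{x\in\mathbb{R}}\min_{u_N\in\mathbb{B}_N(u_N^0,r)}u_N(x)+\mathbb{E}_P[u_N(\xi-x)].$$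
   Context: $\xi$ is a real random variable with distribution $P$ and $r>0$. Let $a=t_1<\dots<t_N=b$. $\mathscr U_L$ is the class of continuous, nondecreasing, concave functions on $[a,b]$ that are Lipschitz with modulus $L$ and satisfy $u(a)=0$, $u(b)=1$. $\mathscr U_N$ is the class of those functions in $\mathscr U_L$ that are piecewise linear with kinks in $\{t_1,\dots,t_N\}$. The utility functions are defined on $[a,b]$ and it is understood that they are only evaluated at arguments $x$ and $\xi-x$ lying in $[a,b]$. For a set $\mathscr G$ of measurable functions on $\mathbb{R}$, $\mathsf d_{\mathscr G}(u,v):=\sup_{g\in\mathscr G}|\langle g,u\rangle-\langle g,v\rangle|$ with $\langle g,u\rangle:=\int g(t)\,du(t)$ (Lebesgue–Stieltjes integral over the domain of $u$). $\mathscr G_K:=\{g:\mathbb{R}\to\mathbb{R}\mid|g(t)-g(t')|\le|t-t'|\ \forall t,t'\}$ and $\mathscr G_I:=\{\mathbf 1_{(a,t]}(\cdot):t\in[a,b]\}$. $\mathbb{B}(u^0,r):=\{u\in\mathscr U_L:\mathsf d_{\mathscr G}(u,u^0)\le r\}$ and $\mathbb{B}_N(u_N^0,r):=\{u_N\in\mathscr U_N:\mathsf d_{\mathscr G}(u_N,u_N^0)\le r\}$. *)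

(* Defs.v *)
From HB Require Import structures.
From mathcomp Require Import all_boot all_order all_algebra.
From mathcomp Require Import all_classical all_reals all_analysis.

Set Implicit Arguments.
Unset Strict Implicit.
Unset Printing Implicit Defensive.

Import Order.TTheory GRing.Theory Num.Theory.
Import numFieldNormedType.Exports.

Local Open Scope classical_set_scope.
Local Open Scope ring_scope.

(* A continuous nondecreasing function on [a, b]. It is carried by a function
   on R whose values outside [a, b] are unconstrained, and never used. *)
Record ndcts (R : realType) (a b : R) := Ndcts {
  ndcts_fun :> R -> R;
  ndcts_continuous : {within `[a, b], continuous ndcts_fun};
  ndcts_nondecreasing : {in `[a, b] &, {homo ndcts_fun : s t / s <= t}} }.

Definition clamp (R : realType) (a b t : R) : R := Num.max a (Num.min t b).

(* The extension of u that is constant on ]-oo, a] and on [b, +oo[: it makes u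
   a cumulative function on R whose Stieltjes measure is carried by [a, b]. *)
Definition ext (R : realType) (a b : R) (u : ndcts a b) : R -> R :=
  fun t => u (clamp a b t).

Section ext_cumulative.
Context (R : realType) (a b : R) (u : ndcts a b).

Lemma clamp_homo : {homo clamp a b : s t / s <= t}.
Proof.
move=> s t st; rewrite /clamp ge_max !le_max lexx /=.
by apply/orP; right; rewrite le_min !ge_min st lexx orbT.
Qed.

Lemma clamp_in t : a <= b -> clamp a b t \in `[a, b].
Proof.
by move=> ab; rewrite in_itv /= /clamp le_max lexx /= ge_max ab ge_min lexx orbT.
Qed.

Lemma clamp_gt t : b < a -> clamp a b t = a.
Proof.
move=> ba; rewrite /clamp; apply/max_idPl.
by rewrite ge_min (ltW ba) orbT.
Qed.

Lemma clamp_continuous : continuous (clamp a b).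
Proof.
move=> t; apply: (@continuous_max R R (cst a) (fun s => Num.min s b)).
  exact: cst_continuous.
apply: (@continuous_min R R id (cst b)); first exact: cvg_id.
exact: cst_continuous.
Qed.

Lemma ext_nondecreasing : nondecreasing (ext u).
Proof.
move=> s t st; rewrite /ext; have [ab|ba] := leP a b.
  by apply: ndcts_nondecreasing; rewrite ?clamp_in ?clamp_homo.
by rewrite !clamp_gt.
Qed.

Lemma ext_continuous : continuous (ext u).
Proof.
move=> t; have [ab|ba] := leP a b; last first.
  rewrite (_ : ext u = cst (u a)); first exact: cst_continuous.
  by apply/funext => s; rewrite /ext clamp_gt.
have ctab : `[a, b]%classic (clamp a b t) by exact: clamp_in.
have /subspace_continuousP /(_ _ ctab) cu := @ndcts_continuous _ _ _ u.
apply: (cvg_trans _ cu) => A /= nA.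
have := @clamp_continuous t _ nA.
by apply: (@filterS _ (nbhs t)) => s; apply; exact: clamp_in.
Qed.

HB.instance Definition _ := isCumulative.Build R _ R (ext u)
  ext_nondecreasing (right_continuousW ext_continuous).

End ext_cumulative.

Section preference.
Context (R : realType).
Implicit Types (a b L r x : R) (N : nat) (t : nat -> R).

Definition concave_on a b (f : R -> R) :=
  forall x y l, x \in `[a, b] -> y \in `[a, b] -> 0 <= l <= 1 ->
    l * f x + (1 - l) * f y <= f (l * x + (1 - l) * y).

Definition U_L a b L : set (ndcts a b) :=
  [set u | [/\ concave_on a b u,
               L.-lipschitz_(`[a, b]) u,
               u a = 0 & u b = 1] ].

(* The grid is t 1 < ... < t N; the other values of t are irrelevant. *)
Definition is_grid a b N t :=
  [/\ t 1%N = a, t N = b & forall i, (1 <= i < N)%N -> t i < t i.+1].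

Definition piecewise_linear N t (f : R -> R) :=
  forall i, (2 <= i <= N)%N ->
    exists c d, forall s, s \in `[t i.-1, t i] -> f s = c + d * s.

Definition U_N a b L N t : set (ndcts a b) :=
  U_L L `&` [set u | piecewise_linear N t u].

Definition is_interpolant N t (f g : R -> R) :=
  forall i, (2 <= i <= N)%N -> forall s, s \in `[t i.-1, t i] ->
    g s = f (t i.-1) + (f (t i) - f (t i.-1)) / (t i - t i.-1) * (s - t i.-1).

Definition mesh N t : R :=
  \big[Num.max/0]_(2 <= i < N.+1) (t i - t i.-1).

Definition pairing a b (g : R -> R) (u : ndcts a b) : \bar R :=
  (\int[lebesgue_stieltjes_measure (ext u)]_(s in `[a, b]) (g s)%:E)%E.

Definition dist a b (G : set (R -> R)) (u v : ndcts a b) : \bar R :=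
  ereal_sup [set `|pairing g u - pairing g v|%E | g in G].

Definition G_K : set (R -> R) :=
  [set g | 1.-lipschitz g ].

Definition G_I a b : set (R -> R) :=
  [set (\1_(`]a, x]) : R -> R) | x in `[a, b]].

Definition ball_in a b (U : set (ndcts a b)) (G : set (R -> R))
    (u0 : ndcts a b) r : set (ndcts a b) :=
  [set u | U u /\ (dist G u u0 <= r%:E)%E].

(* The points x at which both x and, P-almost surely, xi - x lie in [a, b]. *)
Definition feasible a b (P : probability R R) : set R :=
  [set x | x \in `[a, b] /\ {ae P, forall z, z - x \in `[a, b]}].

(* For a feasible x, ext u (z - x) is u (z - x) for P-almost every z, and the
   expectation is that of a bounded measurable function. *)
Definition objective a b (P : probability R R)
    (u : ndcts a b) x : R :=
  u x + fine 'E_P[fun z => ext u (z - x)].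

(* sup and inf of real sets: they are the max and the min when these are
   attained. The inner sets are bounded and, for a nonempty ball, nonempty. *)
Definition robust_value a b (P : probability R R)
    (B : set (ndcts a b)) : R :=
  sup [set inf [set objective P u x | u in B] | x in feasible a b P].

End preference.

(* Main.v *)
Require Import Defs.
From HB Require Import structures.
From mathcomp Require Import all_boot all_order all_algebra.
From mathcomp Require Import all_classical all_reals all_analysis.
From mathcomp Require Import measurable_realfun ring lra zify.

Set Implicit Arguments.
Unset Strict Implicit.
Unset Printing Implicit Defensive.

Import Order.TTheory GRing.Theory Num.Theory.
Import numFieldNormedType.Exports.

Local Open Scope classical_set_scope.
Local Open Scope ring_scope.

(** Both values are max-min problems with the same objective, which moves by at
    most 2 d when the utility moves by at most d uniformly on [a, b]. So it is
    enough to show that every utility in one ambiguity ball is uniformly close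
    to a utility in the other ball ([robust_value_le]).

    Let e = max(2, L) * mesh. A utility and its interpolant are at distance at
    most e ([dist_interpolant]): they agree on the grid, so their
    Riemann-Stieltjes sums coincide, and each sum is within one mesh of the
    integral of a 1-Lipschitz function; and they differ by at most L * mesh
    pointwise. The interpolant of a concave, nondecreasing, L-Lipschitz utility
    is again such a utility, as it is a minimum of chord lines with slopes in
    [0, L] ([U_N_interpolant]).

    Passing from one class and centre to the other therefore produces a utility
    at distance at most r + 2 e from the new centre, perhaps slightly outside
    the new ball. Moving it towards the centre along a segment brings it back
    into the ball ([ball_shrink]). This costs only 2 e in uniform norm: the
    indicators of ]a, x] make the distance dominate the uniform norm, so that
    the contraction factor 2 e / (r + 2 e) applies to a difference of size at
    most r + 2 e, and r drops out. Segments stay in the classes, and the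
    integral is linear along them ([stieltjes_linear]).

    Altogether the utilities are within 3 e of each other and the values within
    6 e, which implies the bound with 10. *)

(** * Lipschitz functions *)

Lemma lipschitz_onP (R : realType) (k : R) (A : set R) (f : R -> R) :
  k.-lipschitz_A f <->
  forall x y, A x -> A y -> `|f x - f y| <= k * `|x - y|.
Proof.
split=> [fk x y Ax Ay|fk [x y] [/= Ax Ay]]; last exact: fk.
by have := fk (x, y); apply.
Qed.

Lemma lipschitz_on_continuous (R : realType) (k : R) (A : set R) (f : R -> R) :
  k.-lipschitz_A f -> {within A, continuous f}.
Proof.
move=> /lipschitz_onP fk; apply/subspace_continuousP => x Ax.
apply/cvgrPdist_le => e e0; near=> y.
have Ay : A y by near: y; exact: withinT.
apply: (le_trans (fk _ _ Ax Ay)).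
have k1 : 0 < `|k| + 1 by rewrite ltr_wpDl.
apply: (@le_trans _ _ ((`|k| + 1) * `|x - y|)).
  by rewrite ler_wpM2r // (le_trans (ler_norm k)) // lerDl.
rewrite mulrC -ler_pdivlMr //.
near: y; apply: cvg_within; apply: filterS (nbhsx_ballx x (e / (`|k| + 1)) _).
  by move=> y /ltW.
by rewrite divr_gt0.
Unshelve. all: by end_near. Qed.

(** * Stieltjes integrals against 1-Lipschitz functions *)

Section stieltjes.
Context (R : realType) (a b : R).
Context (ab : a <= b).
Implicit Types (u v : ndcts a b) (g : R -> R).

Local Notation mu u := (lebesgue_stieltjes_measure (ext u)).

Lemma ext_in u x : x \in `[a, b] -> ext u x = u x.
Proof.
rewrite in_itv /= => /andP[ax xb].
by rewrite /ext /clamp (min_idPl xb) (max_idPr ax).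
Qed.

Lemma stieltjes_oc u x y : x <= y -> mu u `]x, y] = (ext u y - ext u x)%:E.
Proof.
move=> xy; rewrite /lebesgue_stieltjes_measure /measure_extension /=.
rewrite measurable_mu_extE /=; last exact: is_ocitv.
by rewrite wlength_itv_bnd // EFinB.
Qed.

(** The extension of u is constant on ]-oo, a], so the point a is no atom, and
    ]a, x] and [a, x] have the same mass. *)
Lemma stieltjes_left_end u : mu u [set a] = 0%E.
Proof.
apply/eqP; rewrite eq_le measure_ge0 andbT.
have <- : mu u `]a - 1, a] = 0%E.
  rewrite stieltjes_oc ?lerBlDr ?lerDl // /ext.
  have -> : clamp a b (a - 1) = clamp a b a; last by rewrite subrr.
  have aa : a - 1 <= a by rewrite lerBlDr lerDl.
  rewrite /clamp (min_idPl ab) (min_idPl (le_trans aa ab)).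
  by rewrite maxxx (max_idPl aa).
rewrite le_measure ?inE //= => x -> /=.
by rewrite in_itv /= lexx andbT ltrBlDr ltrDl.
Qed.

Lemma stieltjes_cc u x : a <= x -> mu u `[a, x] = (ext u x - ext u a)%:E.
Proof.
move=> ax; rewrite -(@setU1itv _ _ (BRight x) a false) ?bnd_simp //.
rewrite measureU //=.
- transitivity (0 + mu u `]a, x])%E; last by rewrite add0e stieltjes_oc.
  by congr (_ + _)%E; exact: stieltjes_left_end.
- by apply/seteqP; split => // y [/= ->]; rewrite in_itv /= ltxx.
Qed.

Lemma stieltjes_sub_finite u (A : set R) :
  A `<=` `[a, b] -> measurable A -> (mu u A < +oo)%E.
Proof.
move=> Aab mA; apply: (@le_lt_trans _ _ (mu u `[a, b])).
  by rewrite le_measure ?inE.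
by rewrite stieltjes_cc // ltry.
Qed.

Lemma continuous_stieltjes_integrable u g :
  {within `[a, b], continuous g} -> (mu u).-integrable `[a, b] (EFin \o g).
Proof.
move=> cg; apply: measurable_bounded_integrable => //.
- exact: stieltjes_sub_finite.
- exact: subspace_continuous_measurable_fun.
- have /compact_bounded[M [_ mrt]] :=
    continuous_compact cg (@segment_compact _ a b).
  by exists M; split; rewrite ?num_real // => ? ? ? ?; exact: mrt.
Qed.

Lemma G_K_integrable u g : G_K g -> (mu u).-integrable `[a, b] (EFin \o g).
Proof.
move=> gK; apply: continuous_stieltjes_integrable.
apply: (@lipschitz_on_continuous _ 1); apply/lipschitz_onP => x y _ _.
by move/lipschitz_onP : gK; apply.
Qed.

(** The pairing as a real number; [pairing_G_K] justifies it, since a Lipschitz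
    function is integrable on the compact [a, b]. *)
Definition stieltjes g u : R := fine (pairing g u).

Lemma pairing_G_K u g : G_K g -> pairing g u = (stieltjes g u)%:E.
Proof.
move=> gK; rewrite /stieltjes fineK //.
exact: integrable_fin_num (G_K_integrable u gK).
Qed.

(** Through the indicators ]a, x], the pairing sees the values of u: this is
    what turns the distance into a bound on the uniform norm. *)
Lemma pairing_G_I u x : x \in `[a, b] ->
  pairing (\1_(`]a, x]) : R -> R) u = (u x - u a)%:E.
Proof.
move=> xab; rewrite /pairing integral_indic //.
have /andP[ax xb] : a <= x <= b by move: xab; rewrite in_itv.
rewrite (_ : `]a, x]%classic `&` `[a, b]%classic = `]a, x]%classic); last first.
  apply/seteqP; split => [y []//|y] /=; rewrite !in_itv /= => /andP[ay yx].
  by rewrite ay yx (ltW ay) (le_trans yx xb).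
rewrite -(ext_in u xab) -(@ext_in u a) ?in_itv /= ?lexx //.
exact: stieltjes_oc.
Qed.

(** On each cell ]t_i, t_(i+1)] of length at most e, a 1-Lipschitz g differs
    from its value at the right end by at most e; summing the errors weighted by
    the masses of the cells leaves e times the total mass. This single estimate
    replaces any comparison of the Stieltjes measures themselves: it gives both
    the closeness of functions that agree on a grid and, on finer and finer
    grids, the linearity of the integral in u. *)
Lemma stieltjes_riemann_sum u g (t : nat -> R) (n : nat) (e : R) :
  G_K g -> t 0%N = a -> t n <= b ->
  (forall i, (i < n)%N -> t i <= t i.+1 <= t i + e) ->
  `|\int[mu u]_(s in `[a, t n]) g s -
    \sum_(i < n) g (t i.+1) * (u (t i.+1) - u (t i))| <= e * (u (t n) - u a).
Proof.
move=> gK ta; elim: n => [|n IH] tnb tstep.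
  rewrite big_ord0 ta subr0 subrr mulr0 set_itv1.
  rewrite (_ : Rintegral _ _ _ = 0) ?normr0 // /Rintegral.
  rewrite null_set_integral //=; last exact: stieltjes_left_end.
  by apply/measurable_EFinP; exact: measurable_fun_set1.
have /andP[tn tne] := tstep n (ltnSn n).
have tnb' := le_trans tn tnb.
have an : forall k, (k <= n.+1)%N -> a <= t k.
  elim=> [|k IHk] kn; first by rewrite ta.
  by apply: (le_trans (IHk (ltnW kn))); have /andP[] := tstep k kn.
have in1 : t n.+1 \in `[a, b] by rewrite in_itv /= an //= tnb.
have in0 : t n \in `[a, b] by rewrite in_itv /= an //= tnb'.
have tstep' i : (i < n)%N -> t i <= t i.+1 <= t i + e.
  by move=> ni; apply: tstep; exact: ltnW.
have {IH} := IH tnb' tstep'.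
have gint := G_K_integrable u gK.
have subl : `[a, t n.+1] `<=` `[a, b].
  by apply: subset_itvl; rewrite bnd_simp.
have subr : `]t n, t n.+1] `<=` `[a, b].
  by apply: subset_itv; rewrite bnd_simp // an.
have split_last : `[a, t n.+1]%classic = `[a, t n] `|` `]t n, t n.+1].
  by apply: itv_bndbnd_setU; rewrite bnd_simp // an.
rewrite split_last Rintegral_setU //=; last 2 first.
- by rewrite -split_last; exact: integrableS gint.
- apply/disj_setPS => y [/=]; rewrite 2!in_itv/= => /andP[_ yx] /andP[].
  by rewrite ltNge yx.
set I0 := Rintegral _ _ _; set I1 := Rintegral _ _ _.
rewrite big_ord_recr /=; set S := \sum_(i < n) _ => H0.
have H1 : `|I1 - g (t n.+1) * (u (t n.+1) - u (t n))|
    <= e * (u (t n.+1) - u (t n)).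
  have -> : u (t n.+1) - u (t n) = fine (mu u `]t n, t n.+1]).
    by rewrite stieltjes_oc //= !ext_in.
  rewrite -!Rintegral_cst //.
  have cint c : (mu u).-integrable `]t n, t n.+1] (EFin \o cst c).
    apply: measurable_bounded_integrable => //.
    - exact: stieltjes_sub_finite.
    - exact: bounded_cst.
  have gint' : (mu u).-integrable `]t n, t n.+1] (EFin \o g).
    exact: integrableS gint.
  rewrite -RintegralB //; last exact: cint.
  have dint : (mu u).-integrable `]t n, t n.+1]
      (EFin \o (fun s => g s - g (t n.+1))).
    by apply: (integrableB _ gint' (cint _)).
  apply: (le_trans (le_normr_Rintegral _ dint)) => //.
  apply: le_Rintegral => //.
  - exact: integrable_norm dint.
  - exact: cint.
  - move=> s /=; rewrite in_itv /= => /andP[ts st].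
    move/lipschitz_onP : gK => /(_ s (t n.+1) I I) /le_trans; apply.
    rewrite mul1r ler0_norm; lra.
have -> : I0 + I1 - (S + g (t n.+1) * (u (t n.+1) - u (t n))) =
  (I0 - S) + (I1 - g (t n.+1) * (u (t n.+1) - u (t n))) by ring.
apply: (le_trans (ler_normD _ _)); apply: (le_trans (lerD H0 H1)).
by rewrite -mulrDr; lra.
Qed.

Lemma stieltjes_sum_approx u g (t : nat -> R) (n : nat) (e : R) :
  G_K g -> t 0%N = a -> t n = b ->
  (forall i, (i < n)%N -> t i <= t i.+1 <= t i + e) ->
  `|stieltjes g u - \sum_(i < n) g (t i.+1) * (u (t i.+1) - u (t i))|
    <= e * (u b - u a).
Proof.
move=> gK ta tb tstep.
have := stieltjes_riemann_sum u gK ta _ tstep.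
by rewrite tb lexx => /(_ isT).
Qed.

(** Functions equal on the grid have the same Riemann-Stieltjes sum, which is
    within one error term of each integral. *)
Lemma stieltjes_agree u v g (t : nat -> R) (n : nat) (e : R) :
  G_K g -> t 0%N = a -> t n = b ->
  (forall i, (i < n)%N -> t i <= t i.+1 <= t i + e) ->
  (forall i, (i <= n)%N -> u (t i) = v (t i)) ->
  `|stieltjes g u - stieltjes g v| <= e * (u b - u a) *+ 2.
Proof.
move=> gK ta tb tstep uv.
have same_sum : \sum_(i < n) g (t i.+1) * (v (t i.+1) - v (t i)) =
    \sum_(i < n) g (t i.+1) * (u (t i.+1) - u (t i)).
  by apply: eq_bigr => i _; rewrite !uv // ltnW.
have := stieltjes_sum_approx v gK ta tb tstep.
have := stieltjes_sum_approx u gK ta tb tstep.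
have <- : u a = v a by have := uv 0%N isT; rewrite ta.
have <- : u b = v b by have := uv n (leqnn n); rewrite tb.
rewrite same_sum; move: (stieltjes g u) (stieltjes g v) => p q.
set S := \sum_(i < n) _ => Hu Hv.
apply: (le_trans (ler_distD S p q)).
by rewrite mulr2n lerD // distrC.
Qed.

(** The Riemann-Stieltjes sums are linear in u, and on the uniform grid with n
    cells they approximate the three integrals to O(1/n). *)
Lemma stieltjes_linear u v (w : ndcts a b) g (k l : R) :
  (forall x, x \in `[a, b] -> w x = k * u x + l * v x) ->
  G_K g -> stieltjes g w = k * stieltjes g u + l * stieltjes g v.
Proof.
move=> wE gK; apply/eqP; rewrite -subr_eq0 -normr_le0.
have abin : (a \in `[a, b]) * (b \in `[a, b]) by rewrite !in_itv /= !lexx ab.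
have incr u' : 0 <= u' b - u' a.
  by rewrite subr_ge0 ndcts_nondecreasing ?abin.
pose C := (w b - w a) + (`|k| * (u b - u a) + `|l| * (v b - v a)).
have C0 : 0 <= C by do !apply: addr_ge0 => //; apply: mulr_ge0.
apply/ler_addgt0Pr => eps eps0; rewrite add0r.
(* n cells make the error (b - a) * C / n at most eps *)
pose n := (Num.bound ((b - a) * C / eps)).+1.
have n0 : 0 < n%:R :> R by rewrite ltr0n.
pose e := (b - a) / n%:R.
have e0 : 0 <= e by rewrite divr_ge0 ?subr_ge0 // ltW.
pose t i : R := a + i%:R * e.
have tn : t n = b by rewrite /t /e mulrCA mulfV ?lt0r_neq0 // mulr1 subrKC.
have t0 : t 0%N = a by rewrite /t mul0r addr0.
have tstep i : (i < n)%N -> t i <= t i.+1 <= t i + e.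
  by move=> _; rewrite /t -natr1 mulrDl mul1r addrA lexx lerDl e0.
have tin i : (i <= n)%N -> t i \in `[a, b].
  move=> ni; rewrite in_itv /= -[X in _ && (_ <= X)]tn /t lerDl mulr_ge0 //=.
  by rewrite lerD2l ler_wpM2r // ler_nat.
pose S u' := \sum_(i < n) g (t i.+1) * (u' (t i.+1) - u' (t i)).
have SE : S w = k * S u + l * S v.
  rewrite /S !mulr_sumr -big_split /=; apply: eq_bigr => i _.
  by rewrite !wE ?tin // ?(ltnW (ltn_ord i)) //; ring.
have approx u' : `|stieltjes g u' - S u'| <= e * (u' b - u' a).
  exact: stieltjes_sum_approx.
apply: (@le_trans _ _ (e * C)).
  move: (approx w) (approx u) (approx v); rewrite SE.
  move: (stieltjes g w) (stieltjes g u) (stieltjes g v) (S u) (S v).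
  move=> p q q' Su Sv Hp Hq Hq'.
  rewrite (_ : _ - _ = (p - (k * Su + l * Sv)) -
    (k * (q - Su) + l * (q' - Sv))); last by ring.
  apply: (le_trans (ler_normB _ _)); rewrite [e * C]mulrDr; apply: lerD => //.
  apply: (le_trans (ler_normD _ _)); rewrite [e * _]mulrDr.
  by apply: lerD; rewrite normrM mulrCA ler_wpM2l.
rewrite /e mulrAC ler_pdivrMr // [eps * _]mulrC -ler_pdivrMr //.
have q0 : 0 <= (b - a) * C / eps.
  by apply: divr_ge0 (ltW eps0); rewrite mulr_ge0 // subr_ge0.
by apply: (le_trans (ltW (archi_boundP q0))); rewrite ler_nat.
Qed.

(** The part of the distance that comes from the indicators is the uniform
    distance on [a, b]; the other part is the Kantorovich distance. *)
Lemma dist_leP u v (e : R) : u a = v a ->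
  (dist (@G_K R `|` G_I a b) u v <= e%:E)%E <->
  (forall g, G_K g -> `|stieltjes g u - stieltjes g v| <= e) /\
  (forall x, x \in `[a, b] -> `|u x - v x| <= e).
Proof.
move=> uva; split=> [uv|[uvK uvI]].
- split=> [g gK|x xab]; rewrite -lee_fin; apply: le_trans uv.
  + apply: ereal_sup_ubound; exists g; first by left.
    by rewrite !pairing_G_K.
  + apply: ereal_sup_ubound; exists (\1_(`]a, x]) : R -> R).
      by right; exists x.
    rewrite !pairing_G_I // uva -EFinB abse_EFin.
    by congr (`|_|%:E); ring.
- apply: ge_ereal_sup => _ [g [gK|[x /= xab <-]] <-].
    by rewrite !pairing_G_K // lee_fin uvK.
  rewrite !pairing_G_I // uva /= lee_fin.
  by rewrite (_ : _ - _ = u x - v x); [exact: uvI|ring].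
Qed.

End stieltjes.

(** * Convexity of the classes and shrinking onto a ball *)

Lemma U_L_build (R : realType) (a b L : R) (f : R -> R) :
  concave_on a b f -> L.-lipschitz_(`[a, b]) f ->
  {in `[a, b] &, {homo f : s t / s <= t}} -> f a = 0 -> f b = 1 ->
  exists2 u : ndcts a b, U_L L u & ndcts_fun u = f.
Proof.
move=> fconc flip fmono fa fb.
by exists (Ndcts (lipschitz_on_continuous flip) fmono).
Qed.

Definition mixture_closed (R : realType) (a b : R) (U : set (ndcts a b)) :=
  forall u v l, U u -> U v -> 0 <= l <= 1 ->
  exists2 w, U w & forall x, ndcts_fun w x = (1 - l) * u x + l * v x.

Lemma U_L_mixture_closed (R : realType) (a b L : R) :
  mixture_closed (@U_L R a b L).
Proof.
move=> u v l [uc ul ua ub] [vc vl va vb] /andP[l0 l1].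
have l1' : 0 <= 1 - l by rewrite subr_ge0.
have [||||| w wL wE] := @U_L_build R a b L (fun x => (1 - l) * u x + l * v x).
- move=> x y k xab yab k01 /=.
  have := ler_wpM2l l1' (uc x y k xab yab k01).
  have := ler_wpM2l l0 (vc x y k xab yab k01).
  set p := u (_ + _); set q := v (_ + _); lra.
- apply/lipschitz_onP => x y xab yab.
  move/lipschitz_onP : ul => /(_ x y xab yab) ul.
  move/lipschitz_onP : vl => /(_ x y xab yab) vl.
  rewrite (_ : _ - _ = (1 - l) * (u x - u y) + l * (v x - v y)); last by ring.
  apply: (le_trans (ler_normD _ _)).
  rewrite !normrM (ger0_norm l0) (ger0_norm l1').
  apply: (le_trans (lerD (ler_wpM2l l1' ul) (ler_wpM2l l0 vl))).
  by rewrite -mulrDl subrK mul1r.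
- move=> x y xab yab xy.
  by apply: lerD; apply: ler_wpM2l => //; apply: ndcts_nondecreasing.
- by rewrite ua va !mulr0 addr0.
- by rewrite ub vb; ring.
- by exists w => // x; rewrite wE.
Qed.

Lemma U_N_mixture_closed (R : realType) (a b L : R) N (t : nat -> R) :
  mixture_closed (@U_N R a b L N t).
Proof.
move=> u v l [uL uN] [vL vN] l01.
have [w wL wE] := U_L_mixture_closed uL vL l01.
exists w => //; split=> // i iN.
have [c [k uE]] := uN i iN; have [c' [k' vE]] := vN i iN.
exists ((1 - l) * c + l * c'), ((1 - l) * k + l * k') => s si.
by rewrite wE uE // vE //; ring.
Qed.

(** The point w divides the segment from v to the centre u0 in such a way that
    its distance to u0 is scaled by r / (r + e), hence falls to r. It moves v by
    e / (r + e) times u0 - v, whose uniform norm is at most r + e because the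
    distance dominates the uniform norm: so by at most e, whatever the size
    of r. *)
Lemma ball_shrink (R : realType) (a b L r e : R) (U : set (ndcts a b))
    (u0 v : ndcts a b) :
  a <= b -> 0 < r -> 0 <= e -> mixture_closed U -> U `<=` U_L L ->
  U u0 -> U v -> (dist (@G_K R `|` G_I a b) v u0 <= (r + e)%:E)%E ->
  exists2 w, ball_in U (@G_K R `|` G_I a b) u0 r w &
    forall x, x \in `[a, b] -> `|w x - v x| <= e.
Proof.
move=> ab r0 e0 Umix UL Uu0 Uv.
have [_ _ u0a _] := UL _ Uu0; have [_ _ va _] := UL _ Uv.
move=> /(dist_leP ab _ (etrans va (esym u0a)))[vK vI].
have re0 : 0 < r + e by rewrite ltr_pwDl.
pose l := e / (r + e).
have l0 : 0 <= l by rewrite divr_ge0 // ltW.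
have lre : l * (r + e) = e by rewrite /l divfK // lt0r_neq0.
have l1 : l <= 1 by rewrite /l ler_pdivrMr // mul1r lerDr ltW.
have [w Uw wE] := Umix v u0 l Uv Uu0 (introT andP (conj l0 l1)).
have shrinks (y z : R) : `|y - z| <= r + e -> `|(1 - l) * y + l * z - z| <= r.
  move=> yz; rewrite (_ : _ - _ = (1 - l) * (y - z)); last by ring.
  have l1' : 0 <= 1 - l by rewrite subr_ge0.
  rewrite normrM ger0_norm //; apply: (le_trans (ler_wpM2l l1' yz)).
  by rewrite mulrBl lre mul1r addrK.
exists w.
- split=> //; apply/(dist_leP ab).
    by rewrite wE va u0a; ring.
  split=> [g gK|x xab]; last by rewrite wE; exact/shrinks/vI.
  rewrite (@stieltjes_linear _ _ _ ab v u0 _ _ (1 - l) l) //.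
  exact/shrinks/vK.
- move=> x xab; rewrite wE.
  rewrite (_ : _ - _ = l * (u0 x - v x)); last by ring.
  by rewrite normrM (ger0_norm l0) -[leRHS]lre ler_wpM2l // distrC vI.
Qed.

(** * Chords of a concave function *)

Section chords.
Context (R : realType).
Implicit Types (f : R -> R) (p q s x y z : R).

Definition chord f p q s : R := f p + (f q - f p) / (q - p) * (s - p).

Lemma chord_left f p q : chord f p q p = f p.
Proof. by rewrite /chord subrr mulr0 addr0. Qed.

Lemma chord_right f p q : p < q -> chord f p q q = f q.
Proof.
by move=> pq; rewrite /chord divfK ?subrKC // subr_eq0 gt_eqF.
Qed.

Lemma chord_shift f p q x y :
  chord f p q y = chord f p q x + (f q - f p) / (q - p) * (y - x).
Proof. by rewrite /chord; ring. Qed.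

(** Concavity cleared of denominators: y has the weights (z - y) / (z - x) on x
    and (y - x) / (z - x) on z. *)
Lemma concave_three_points a b f x y z : concave_on a b f ->
  x \in `[a, b] -> z \in `[a, b] -> x <= y -> y <= z -> x < z ->
  (z - y) * f x + (y - x) * f z <= (z - x) * f y.
Proof.
move=> fc xab zab xy yz xz.
have zx : 0 < z - x by rewrite subr_gt0.
have zx0 : z - x != 0 by rewrite gt_eqF.
pose l := (z - y) / (z - x).
have l01 : 0 <= l <= 1.
  by rewrite /l ler_pdivlMr // mul0r ler_pdivrMr // mul1r; lra.
have := fc x z l xab zab l01.
have -> : l * x + (1 - l) * z = y by rewrite /l; field.
move/(ler_wpM2l (ltW zx)); apply: le_trans; rewrite le_eqVlt; apply/orP; left.
by apply/eqP; rewrite /l; field.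
Qed.

Lemma chord_above a b f p q s : concave_on a b f ->
  p \in `[a, b] -> q \in `[a, b] -> s \in `[a, b] -> p < q ->
  s <= p \/ q <= s -> f s <= chord f p q s.
Proof.
move=> fc pab qab sab pq out.
have qp : 0 < q - p by rewrite subr_gt0.
rewrite -(ler_pM2l qp).
have -> : (q - p) * chord f p q s = (q - p) * f p + (f q - f p) * (s - p).
  by rewrite /chord; field; rewrite gt_eqF.
case: out => [sp|qs].
- have := concave_three_points fc sab qab sp (ltW pq) (le_lt_trans sp pq).
  lra.
- have := concave_three_points fc pab sab (ltW pq) qs (lt_le_trans pq qs).
  lra.
Qed.

Lemma chord_le_affine f p q c k s : p < q -> p <= s <= q ->
  f p <= c + k * p -> f q <= c + k * q -> chord f p q s <= c + k * s.
Proof.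
move=> pq /andP[ps sq] fp fq.
have qp : 0 < q - p by rewrite subr_gt0.
rewrite -(ler_pM2l qp).
have -> : (q - p) * chord f p q s = (q - s) * f p + (s - p) * f q.
  by rewrite /chord; field; rewrite gt_eqF.
have qs0 : 0 <= q - s by rewrite subr_ge0.
have sp0 : 0 <= s - p by rewrite subr_ge0.
have := ler_wpM2l qs0 fp; have := ler_wpM2l sp0 fq; lra.
Qed.

End chords.

(** * Piecewise linear interpolation on a grid *)

Section grid.
Context (R : realType) (a b L : R) (N : nat) (t : nat -> R).
Context (N1 : (1 < N)%N) (tgrid : is_grid a b N t).

Lemma grid_le i j : (1 <= i)%N -> (i <= j)%N -> (j <= N)%N -> t i <= t j.
Proof.
have [_ _ tS] := tgrid.
move=> i1; elim: j => [|j IH]; first by rewrite leqn0 => /eqP->.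
rewrite leq_eqVlt => /predU1P[-> //|ij] jN.
rewrite (le_trans (IH ij (ltnW jN))) // ltW // tS // jN andbT.
exact: leq_trans i1 ij.
Qed.

Lemma grid_in i : (1 <= i <= N)%N -> t i \in `[a, b].
Proof.
have [<- <- _] := tgrid.
by move=> /andP[i1 iN]; rewrite in_itv /= !grid_le // ltnW.
Qed.

Lemma grid_step i : (2 <= i <= N)%N -> t i.-1 < t i.
Proof.
case: i => [//|i] /andP[i1 iN] /=; have [_ _ tS] := tgrid.
by apply: tS; rewrite -ltnS i1.
Qed.

Lemma grid_step_mesh i : (2 <= i <= N)%N -> t i - t i.-1 <= mesh N t.
Proof.
move=> iN; rewrite /mesh.
apply: (le_bigmax_seq _ _ _ (fun i => t i - t i.-1)) => //.
by rewrite mem_index_iota ltnS.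
Qed.

Lemma mesh_ge0 : 0 <= mesh N t.
Proof. exact: bigmax_ge_id. Qed.

Lemma grid_ab : a < b.
Proof.
have [ta tb _] := tgrid; rewrite -ta -tb.
apply: (@lt_le_trans _ _ (t 2%N)); first by rewrite (grid_step (i := 2)).
exact: grid_le.
Qed.

Lemma grid_locate x : x \in `[a, b] ->
  exists2 i, (2 <= i <= N)%N & x \in `[t i.-1, t i].
Proof.
have [ta tb _] := tgrid.
rewrite in_itv /= -ta -tb => /andP[ax].
suff H n : (2 <= n <= N)%N -> x <= t n ->
    exists2 i, (2 <= i <= N)%N & x \in `[t i.-1, t i].
  by move=> xb; apply: (H N) => //; rewrite leqnn andbT.
elim: n => [//|n IH] nN xn; have [xn'|nx] := leP x (t n); last first.
  by exists n.+1 => //; rewrite in_itv /= xn (ltW nx).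
case/andP: nN; rewrite ltnS leq_eqVlt => /predU1P[n1|n1] nN.
  move: xn; rewrite -n1 => xn.
  by exists 2%N; rewrite ?N1 // in_itv /= ax xn.
by apply: IH => //; rewrite n1 ltnW.
Qed.

Let chord_i (u : R -> R) i s := chord u (t i.-1) (t i) s.

(** For a concave nondecreasing u, the piecewise linear interpolant minimizes the
    lines through consecutive points of its graph over the grid. In this form
    monotonicity, concavity and the Lipschitz bound pass from the lines to the
    interpolant, with no discussion of the cells that contain the arguments. The
    constant line u b, which is never below u, starts the minimum. *)
Definition interpolant (u : R -> R) (s : R) : R :=
  \big[Num.min/u b]_(2 <= i < N.+1) chord_i u i s.

Lemma le_interpolant u s z :
  z <= interpolant u s <->
  z <= u b /\ forall i, (2 <= i <= N)%N -> z <= chord_i u i s.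
Proof.
split=> [zI|[zb zi]].
- split=> [|i iN]; apply: (le_trans zI); first exact: bigmin_le_id.
  apply: (ge_bigmin_seq _ _ _ (fun i => chord_i u i s));
    by rewrite ?mem_index_iota ?ltnS.
- by rewrite /interpolant big_nat; apply: le_bigmin.
Qed.

(** On the cell of i the line of i is below every other line: outside its own
    cell the line of j is above the concave u, so at both ends of the cell of i
    it is above the line of i, and two affine functions compare between two
    points at which they compare. *)
Lemma interpolant_chord (u : ndcts a b) i s : concave_on a b u ->
  (2 <= i <= N)%N -> s \in `[t i.-1, t i] -> interpolant u s = chord_i u i s.
Proof.
move=> uc iN si.
have [i2 iN'] := andP iN.
have [pab qab] : t i.-1 \in `[a, b] /\ t i \in `[a, b].
  by split; apply: grid_in; lia.
have pq := grid_step iN.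
have si' : t i.-1 <= s <= t i by move: si; rewrite in_itv.
apply/eqP; rewrite eq_le; apply/andP; split.
  by have /le_interpolant[_] := lexx (interpolant u s); apply.
apply/le_interpolant; split=> [|j jN].
  have ub p : p \in `[a, b] -> u p <= u b.
    move=> pab'; apply: ndcts_nondecreasing => //.
      by rewrite in_itv /= lexx (ltW grid_ab).
    by move: pab'; rewrite in_itv /= => /andP[].
  have := @chord_le_affine _ u (t i.-1) (t i) (u b) 0 s pq si'.
  by rewrite !mul0r !addr0; apply; exact: ub.
have [->//|ij] := eqVneq j i.
have [j2 jN'] := andP jN.
have [pabj qabj] : t j.-1 \in `[a, b] /\ t j \in `[a, b].
  by split; apply: grid_in; lia.
pose k := (u (t j) - u (t j.-1)) / (t j - t j.-1).
have chordE x : chord_i u j x = (u (t j.-1) - k * t j.-1) + k * x.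
  by rewrite /chord_i /chord -/k; ring.
have above x : x \in `[a, b] -> x <= t j.-1 \/ t j <= x ->
    u x <= (u (t j.-1) - k * t j.-1) + k * x.
  move=> xab out; rewrite -chordE.
  by apply: (chord_above uc) => //; exact: grid_step.
have sep : (j <= i.-1)%N \/ (i <= j.-1)%N by move: ij iN jN; clear; lia.
rewrite chordE; apply: chord_le_affine => //; apply: above => //.
- case: sep => sep; [right|left]; apply: grid_le; move: sep iN jN; clear; lia.
- case: sep => sep; [right|left]; apply: grid_le; move: sep iN jN; clear; lia.
Qed.

Lemma chord_slope (u : ndcts a b) i : L.-lipschitz_(`[a, b]) u ->
  (2 <= i <= N)%N ->
  0 <= (u (t i) - u (t i.-1)) / (t i - t i.-1) <= L.
Proof.
move=> ul iN; have pq := grid_step iN.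
have [pab qab] : t i.-1 \in `[a, b] /\ t i \in `[a, b].
  by split; apply: grid_in; lia.
rewrite ler_pdivlMr ?subr_gt0 // mul0r subr_ge0.
rewrite ler_pdivrMr ?subr_gt0 // ndcts_nondecreasing ?(ltW pq) //=.
move/lipschitz_onP : ul => /(_ _ _ qab pab).
rewrite (@ger0_norm _ (t i - t i.-1)) ?subr_ge0 ?(ltW pq) //.
by apply: le_trans; exact: ler_norm.
Qed.

Lemma U_N_interpolant (u : ndcts a b) : U_L L u ->
  exists2 w : ndcts a b, U_N L N t w & is_interpolant N t u w.
Proof.
move=> [uc ul ua ub].
have onI i s : (2 <= i <= N)%N -> s \in `[t i.-1, t i] ->
    interpolant u s = chord_i u i s.
  exact: interpolant_chord.
have below s : interpolant u s <= u b /\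
    forall i, (2 <= i <= N)%N -> interpolant u s <= chord_i u i s.
  exact/le_interpolant.
have [ta tb _] := tgrid.
have L0 : 0 <= L.
  have /andP[] := chord_slope ul (introT andP (conj (leqnn 2) N1)).
  exact: le_trans.
(* every line has slope at most L, so the minimum at y exceeds the minimum at x
   by at most L * |x - y| *)
have lip x y : interpolant u y <= interpolant u x + L * `|x - y|.
  rewrite -lerBlDr; apply/le_interpolant; split=> [|i iN].
    rewrite lerBlDr (le_trans (below y).1) // lerDl mulr_ge0 //.
  rewrite lerBlDr (le_trans ((below y).2 i iN)) //.
  rewrite /chord_i (chord_shift _ _ _ x y) lerD2l.
  have /andP[k0 kL] := chord_slope ul iN.
  apply: (@le_trans _ _ ((u (t i) - u (t i.-1)) / (t i - t i.-1) * `|x - y|)).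
    by rewrite ler_wpM2l // distrC ler_norm.
  by rewrite ler_wpM2r.
have [||||| w wL wE] := @U_L_build R a b L (interpolant u).
- move=> x y l _ _ /andP[l0 l1]; apply/le_interpolant.
  have l1' : 0 <= 1 - l by rewrite subr_ge0.
  split=> [|i iN].
    have := ler_wpM2l l0 (below x).1; have := ler_wpM2l l1' (below y).1; lra.
  have := ler_wpM2l l0 ((below x).2 i iN).
  have := ler_wpM2l l1' ((below y).2 i iN).
  rewrite /chord_i /chord; set k := _ / _; lra.
- apply/lipschitz_onP => x y _ _; rewrite ler_norml lerBlDr lerBrDr.
  by rewrite addrC lerBlDr lip addrC distrC lip.
- move=> x y _ _ xy; apply/le_interpolant; split=> [|i iN].
    exact: (below x).1.
  apply: (le_trans ((below x).2 i iN)).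
  rewrite /chord_i (chord_shift _ _ _ x y) lerDl mulr_ge0 ?subr_ge0 //.
  by have /andP[] := chord_slope ul iN.
- have t1I : t 1%N \in `[t 1%N, t 2%N] by rewrite in_itv /= lexx grid_le.
  have := onI 2%N _ N1 t1I.
  by rewrite /chord_i chord_left /= ta ua.
- have tNI : t N \in `[t N.-1, t N].
    by rewrite in_itv /= lexx andbT grid_le; lia.
  have NN : (2 <= N <= N)%N by lia.
  have := onI N _ NN tNI.
  by rewrite /chord_i chord_right ?grid_step // tb ub.
- exists w; last by move=> i iN s si; rewrite wE; exact: onI.
  split=> // i iN; rewrite wE.
  pose k := (u (t i) - u (t i.-1)) / (t i - t i.-1).
  exists (u (t i.-1) - k * t i.-1), k => s si.
  by rewrite (onI i s iN si) /chord_i /chord -/k; ring.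
Qed.

(** Kantorovich part: u and w agree on the grid and have total mass 1, which
    gives 2 * mesh. Uniform part: on a cell both functions lie between the
    common values at its ends, and these differ by at most L * mesh. *)
Lemma dist_interpolant (u w : ndcts a b) : U_L L u -> U_L L w ->
  is_interpolant N t u w ->
  (dist (@G_K R `|` G_I a b) u w <= (Num.max 2 L * mesh N t)%:E)%E.
Proof.
move=> [_ ul ua ub] [_ _ wa wb] wI.
have ab := ltW grid_ab; have [ta tb _] := tgrid.
have onchord i s : (2 <= i <= N)%N -> s \in `[t i.-1, t i] ->
    w s = chord_i u i s.
  by move=> iN si; exact: (wI i iN s si).
have wu i : (1 <= i <= N)%N -> u (t i) = w (t i).
  move=> /andP[i1 iN].
  move: i1; rewrite leq_eqVlt => /predU1P[<-|i2].
    have t1I : t 1%N \in `[t 1%N, t 2%N] by rewrite in_itv /= lexx grid_le.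
    by rewrite (onchord 2%N _ N1 t1I) /chord_i chord_left.
  have iN2 : (2 <= i <= N)%N by rewrite i2 iN.
  have pq := grid_step iN2.
  have tiI : t i \in `[t i.-1, t i] by rewrite in_itv /= lexx (ltW pq).
  by rewrite (onchord i _ iN2 tiI) /chord_i chord_right.
apply/(dist_leP ab); first by rewrite ua wa.
split=> [g gK|x xab].
- apply: (@le_trans _ _ (mesh N t * (u b - u a) *+ 2)).
    apply: (@stieltjes_agree _ _ _ ab _ _ _ (fun i => t i.+1) N.-1) => //.
    + by rewrite prednK // ltnW.
    + move=> i iN; rewrite (ltW (grid_step (i := i.+2) _)) /=; last by lia.
      by rewrite addrC -lerBlDr (grid_step_mesh (i := i.+2)) //; lia.
    + by move=> i iN; apply: wu; lia.
  rewrite ub ua subr0 mulr1 -mulr_natl ler_wpM2r ?mesh_ge0 //.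
  by rewrite le_max lexx.
- have [i iN xi] := grid_locate xab.
  have [pab qab] : t i.-1 \in `[a, b] /\ t i \in `[a, b].
    by split; apply: grid_in; lia.
  have pq := grid_step iN.
  move: (xi); rewrite in_itv /= => /andP[px xq].
  have i1 : (1 <= i.-1 <= N)%N by lia.
  have i2 : (1 <= i <= N)%N by lia.
  have := ndcts_nondecreasing u pab xab px.
  have := ndcts_nondecreasing u xab qab xq.
  have := ndcts_nondecreasing w pab xab px.
  have := ndcts_nondecreasing w xab qab xq.
  rewrite -!wu // => w2 w1 u2 u1.
  have : `|u (t i) - u (t i.-1)| <= L * `|t i - t i.-1|.
    by move/lipschitz_onP : ul; apply.
  rewrite (@ger0_norm _ (t i - _)) ?subr_ge0 ?(ltW pq) // => Lup.
  have Mup : L * (t i - t i.-1) <= Num.max 2 L * mesh N t.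
    apply: (@le_trans _ _ (Num.max 2 L * (t i - t i.-1))).
      by rewrite ler_wpM2r ?subr_ge0 ?(ltW pq) // le_max lexx orbT.
    by rewrite ler_wpM2l ?grid_step_mesh // le_max ler0n.
  have := le_trans (ler_norm _) (le_trans Lup Mup).
  rewrite ler_norml; lra.
Qed.

End grid.

(** * Stability of the robust value *)

Lemma Rintegral_prob_cst d (T : measurableType d) (R : realType)
  (P : probability T R) (c : R) : \int[P]_(_ in setT) c = c.
Proof.
transitivity (c * fine (P setT)); first exact: Rintegral_cst.
by rewrite probability_setT mulr1.
Qed.

Section robust.
Context (R : realType) (a b L : R) (P : probability R R).
Context (ab : a <= b).
Implicit Types (u v : ndcts a b) (B : set (ndcts a b)).

Lemma U_L_unit_range u x : U_L L u -> x \in `[a, b] -> 0 <= u x <= 1.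
Proof.
move=> [_ _ <- <-] xab; move: (xab); rewrite in_itv /= => /andP[ax xb].
by rewrite !ndcts_nondecreasing // ?in_itv /= ?lexx ?ab.
Qed.

Lemma ext_integrable u x : U_L L u ->
  P.-integrable setT (EFin \o (fun z => ext u (z - x))).
Proof.
move=> uL; apply: measurable_bounded_integrable => //.
- by rewrite (le_lt_trans (probability_le1 _ _)) // ltry.
- apply: continuous_measurable_fun => z.
  apply: (@continuous_comp _ _ _ (fun z => z - x) (ext u)).
    by apply: cvgB; [exact: cvg_id|exact: cvg_cst].
  exact: ext_continuous.
- exists 1; split; first exact: num_real.
  move=> M M1 z _ /=; apply: le_trans (ltW M1).
  have /andP[u0 u1] := U_L_unit_range uL (clamp_in (z - x) ab).
  by rewrite /ext ger0_norm.
Qed.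

Lemma objectiveE u x :
  objective P u x = u x + \int[P]_(z in setT) ext u (z - x).
Proof. by rewrite /objective unlock. Qed.

Lemma objective_range u x : U_L L u -> x \in `[a, b] ->
  0 <= objective P u x <= 2.
Proof.
move=> uL xab; rewrite objectiveE.
have /andP[u0 u1] := U_L_unit_range uL xab.
have I0 : 0 <= \int[P]_(z in setT) ext u (z - x).
  apply: Rintegral_ge0 => z _.
  by have /andP[] := U_L_unit_range uL (clamp_in (z - x) ab).
have I1 : \int[P]_(z in setT) ext u (z - x) <= 1.
  rewrite -[leRHS](Rintegral_prob_cst P).
  apply: le_Rintegral => //; first exact: ext_integrable.
    exact: finite_measure_integrable_cst.
  by move=> z _; have /andP[] := U_L_unit_range uL (clamp_in (z - x) ab).
lra.
Qed.

(** The utility enters the objective twice, as u(x) and in the expectation,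
    hence the factor 2. *)
Lemma objective_le u v x (e : R) : U_L L u -> U_L L v -> x \in `[a, b] ->
  (forall y, y \in `[a, b] -> `|u y - v y| <= e) ->
  objective P u x <= objective P v x + 2 * e.
Proof.
move=> uL vL xab uv; rewrite !objectiveE.
have uv_le y : y \in `[a, b] -> u y <= v y + e.
  by move=> /uv /(le_trans (ler_norm _)); rewrite lerBlDl.
have : \int[P]_(z in setT) ext u (z - x) <=
       \int[P]_(z in setT) ext v (z - x) + e.
  rewrite -[e in leRHS](Rintegral_prob_cst P).
  have eint := finite_measure_integrable_cst P e (@measurableT _ R).
  rewrite -RintegralD //; last exact: ext_integrable.
  apply: le_Rintegral => //; first exact: ext_integrable.
    exact: (integrableD measurableT (ext_integrable x vL) eint).
  by move=> z _; apply: uv_le; exact: clamp_in.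
have := uv_le x xab; lra.
Qed.

(** At each x, the competitors in B of the elements of B' keep the minimum over
    B within the change of objective above the minimum over B', and the maximum
    over x preserves this bound. *)
Lemma robust_value_le B B' (e : R) : B `<=` U_L L -> B' `<=` U_L L ->
  B' !=set0 -> 0 <= e ->
  (forall v, B' v -> exists2 u, B u &
     forall y, y \in `[a, b] -> `|u y - v y| <= e) ->
  robust_value P B <= robust_value P B' + 2 * e.
Proof.
move=> BL B'L B'0 e0 near_B; rewrite /robust_value.
have in_ab x : feasible a b P x -> x \in `[a, b] by case.
have obj0 (C : set (ndcts a b)) : C `<=` U_L L -> forall x, feasible a b P x ->
    has_lbound [set objective P u x | u in C].
  move=> CL x /in_ab xab; exists 0 => _ [u /CL uL <-].
  by have /andP[] := objective_range uL xab.
have inf_le x : feasible a b P x ->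
    inf [set objective P u x | u in B] <=
    inf [set objective P u x | u in B'] + 2 * e.
  move=> xf; rewrite -lerBlDr; apply: lb_le_inf.
    by have [v B'v] := B'0; exists (objective P v x), v.
  move=> _ [v B'v <-]; rewrite lerBlDr.
  have [u Bu uv] := near_B v B'v.
  apply: (@le_trans _ _ (objective P u x)).
    by apply: ge_inf; [exact: (obj0 B)|exists u].
  by apply: objective_le => //; [exact: BL|exact: B'L|exact: in_ab].
(* without feasible points both values are the supremum of the empty set *)
have [[x0 x0f]|nof] := pselect (feasible a b P !=set0); last first.
  have -> : feasible a b P = set0.
    by apply/seteqP; split => // x xf; case: nof; exists x.
  by rewrite !image_set0 sup0 add0r mulr_ge0.
apply: ge_sup; first by exists (inf [set objective P u x0 | u in B]), x0.
move=> _ [x xf <-]; apply: (le_trans (inf_le x xf)); rewrite lerD2r.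
apply: ub_le_sup; last by exists x.
exists 2 => _ [y yf <-]; have [v B'v] := B'0.
apply: (@le_trans _ _ (objective P v y)).
  by apply: ge_inf; [exact: (obj0 B')|exists v].
by have /andP[] := objective_range (B'L _ B'v) (in_ab _ yf).
Qed.

End robust.

(** Write e for the bound of [dist_interpolant]. From the ball around u0 to the
    ball around its interpolant, interpolating costs e and puts the interpolant
    at distance at most r + 2 e from the new centre, so that shrinking costs
    2 e; in the other direction only a shrinking by e takes place. The cost is
    thus at most 3 e, and it is doubled in the objective. *)
Lemma robust_value_interpolation (R : realType) (a b L r : R) (N : nat)
  (t : nat -> R) (P : probability R R) (u0 uN0 : ndcts a b)
  (G := @G_K R `|` G_I a b) :
  0 < r -> (1 < N)%N -> is_grid a b N t ->
  U_L L u0 -> U_N L N t uN0 -> is_interpolant N t u0 uN0 ->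
  `|robust_value P (ball_in (U_L L) G u0 r) -
    robust_value P (ball_in (U_N L N t) G uN0 r)|
  <= 6 * (Num.max 2 L * mesh N t).
Proof.
move=> r0 N1 tgrid u0L uN0N uN0I.
have ab := ltW (grid_ab N1 tgrid).
have UNL : U_N L N t `<=` @U_L R a b L by move=> ? [].
have m0 : 0 <= mesh N t by exact: mesh_ge0.
pose e := Num.max 2 L * mesh N t.
have e0 : 0 <= e by rewrite mulr_ge0 // le_max ler0n.
have eq0 (u v : ndcts a b) : U_L L u -> U_L L v -> u a = v a.
  by move=> [_ _ -> _] [_ _ ->].
have distP (u v : ndcts a b) (k : R) : U_L L u -> U_L L v ->
    (dist G u v <= k%:E)%E <->
    (forall g, G_K g -> `|stieltjes g u - stieltjes g v| <= k) /\
    (forall x, x \in `[a, b] -> `|u x - v x| <= k).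
  by move=> uL vL; apply: dist_leP => //; exact: eq0.
have distD (u v w : ndcts a b) (k l : R) : U_L L u -> U_L L v -> U_L L w ->
    (dist G u v <= k%:E)%E -> (dist G v w <= l%:E)%E ->
    (dist G u w <= (k + l)%:E)%E.
  move=> uL vL wL /(distP _ _ _ uL vL)[uvK uvI] /(distP _ _ _ vL wL)[vwK vwI].
  apply/(distP _ _ _ uL wL); split=> [g gK|x xab].
    apply: (le_trans (ler_distD (stieltjes g v) _ _)).
    exact: lerD (uvK g gK) (vwK g gK).
  exact: (le_trans (ler_distD (v x) _ _) (lerD (uvI x xab) (vwI x xab))).
have dist_sym (u v : ndcts a b) (k : R) : U_L L u -> U_L L v ->
    (dist G u v <= k%:E)%E -> (dist G v u <= k%:E)%E.
  move=> uL vL /(distP _ _ _ uL vL)[uvK uvI]; apply/(distP _ _ _ vL uL).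
  by split=> *; rewrite distrC; [exact: uvK|exact: uvI].
have center (U : set (ndcts a b)) u : U `<=` U_L L -> U u ->
    ball_in U G u r !=set0.
  move=> UL Uu; exists u; split=> //; apply/(distP _ _ _ (UL _ Uu) (UL _ Uu)).
  by split=> *; rewrite subrr normr0 ltW.
have uN0L := UNL _ uN0N.
have u0e : (dist G u0 uN0 <= e%:E)%E by exact: dist_interpolant.
have e3 : 0 <= 3 * e by rewrite mulr_ge0.
have toN u : ball_in (U_L L) G u0 r u ->
    exists2 w, ball_in (U_N L N t) G uN0 r w &
      forall x, x \in `[a, b] -> `|w x - u x| <= 3 * e.
  move=> [uL ur]; have [v vN vI] := U_N_interpolant N1 tgrid uL.
  have vL := UNL _ vN.
  have uve : (dist G u v <= e%:E)%E by exact: dist_interpolant.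
  have vr : (dist G v uN0 <= (r + 2 * e)%:E)%E.
    have := distD _ _ _ _ _ vL uL uN0L (dist_sym _ _ _ uL vL uve)
      (distD _ _ _ _ _ uL u0L uN0L ur u0e).
    by rewrite (_ : e + (r + e) = r + 2 * e) //; ring.
  have e2 : 0 <= 2 * e by rewrite mulr_ge0.
  have [w wB wv] :=
    ball_shrink ab r0 e2 (@U_N_mixture_closed R a b L N t) UNL uN0N vN vr.
  exists w => // x xab.
  have /(distP _ _ _ uL vL)[_ /(_ x xab) uv] := uve.
  apply: (le_trans (ler_distD (v x) _ _)); rewrite distrC in uv.
  by have := lerD (wv x xab) uv; lra.
have fromN w : ball_in (U_N L N t) G uN0 r w ->
    exists2 u, ball_in (U_L L) G u0 r u &
      forall x, x \in `[a, b] -> `|u x - w x| <= 3 * e.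
  move=> [/UNL wL wr].
  have wr' : (dist G w u0 <= (r + e)%:E)%E.
    exact: distD _ _ _ _ _ wL uN0L u0L wr (dist_sym _ _ _ u0L uN0L u0e).
  have [u uB uw] :=
    ball_shrink ab r0 e0 (@U_L_mixture_closed R a b L) (@subset_refl _ _)
      u0L wL wr'.
  by exists u => // x xab; have := uw x xab; lra.
have BL : ball_in (U_L L) G u0 r `<=` @U_L R a b L by move=> ? [].
have BNL : ball_in (U_N L N t) G uN0 r `<=` @U_L R a b L by move=> ? [/UNL].
have B0 : ball_in (U_L L) G u0 r !=set0 by exact: center.
have BN0 : ball_in (U_N L N t) G uN0 r !=set0 by exact: center.
have le1 := robust_value_le P ab BL BNL BN0 e3 fromN.
have le2 := robust_value_le P ab BNL BL B0 e3 toN.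
have -> : 6 * (Num.max 2 L * mesh N t) = 2 * (3 * e) by rewrite /e; ring.
rewrite ler_distl lerBlDr; apply/andP; split; [exact: le2|exact: le1].
Qed.

Theorem theorem4p2 (R : realType) (a b L r : R) (N : nat) (t : nat -> R)
  (d : measure_display) (Omega : measurableType d) (Pr : probability Omega R)
  (xi : {RV Pr >-> R}) (u0 uN0 : ndcts a b) :
  0 < r -> (1 < N)%N -> is_grid a b N t ->
  U_L L u0 -> U_N L N t uN0 -> is_interpolant N t u0 uN0 ->
  let P : probability R R := distribution Pr xi in
  let G := @G_K R `|` G_I a b in
  let Rval := robust_value P (ball_in (U_L L) G u0 r) in
  let RNval := robust_value P (ball_in (U_N L N t) G uN0 r) in
  `|Rval - RNval| <= 10 * Num.max 2 L * mesh N t.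
Proof.
move=> r0 N1 tgrid u0L uN0N uN0I.
apply: (le_trans (robust_value_interpolation _ r0 N1 tgrid u0L uN0N uN0I)).
rewrite -mulrA ler_wpM2r ?ler_nat //.
by rewrite mulr_ge0 ?mesh_ge0 // le_max ler0n.
Qed.
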